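(* Let $P$ be a well-typed program (with signature sets $\mathcal{F}(f)$ and $\mathcal{F}^{\mathrm{cf}}(f)$ for each function $f$ of $P$), let $\Gamma$ be a typing environment, $\mathcal{G}$ a set of guard predicates, $e$ an expression, $\alpha$ a type, $\Psi,\Phi$ resource functions, and let $\sigma$ be a substitution mapping program variables to values that respects the types in $\Gamma$. Suppose $\sigma \vdash^{c} e \Rightarrow v$, i.e. $e$ evaluates under $\sigma$ to the value $v$ with cost $c$. (1) If $\Gamma;\mathcal{G}\mid\Psi \vdash e:\alpha\mid\Phi$, then $$\bigwedge\mathcal{G}\ \Longrightarrow\ \Psi(\Gamma\sigma)\ \ge\ c+\Phi(v).$$ (2) If the cost-free judgement $\Gamma;\mathcal{G}\mid\Psi \vdash^{\mathrm{cf}} e:\alpha\mid\Phi$ holds, then $$\bigwedge\mathcal{G}\ \Longrightarrow\ \Psi(\Gamma\sigma)\ \ge\ \Phi(v).$$ Here $\bigwedge\mathcal{G}$ means that all guard predicates in $\mathcal{G}$ are true under $\sigma$, and $\Psi(\Gamma\sigma)$ is the value of $\Psi$ at the values $\sigma(x)$, $x\in\mathrm{dom}(\Gamma)$.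
   Context: **Values and types.** Data types have finitely many constructors; each constructor $\mathsf{c}$ has a fixed type $\vec\alpha\to\alpha$. The types are $\mathsf{Bool}$ (nullary constructors $\mathsf{true},\mathsf{false}$), an abstract base type $\mathsf{B}$ (a totally ordered set of values carrying no potential), and trees $\mathsf{T}$ with constructors $\mathsf{leaf}:\mathsf{T}$ and $\mathsf{node}:\mathsf{T}\times\mathsf{B}\times\mathsf{T}\to\mathsf{T}$. Measures on trees: weight $\#\mathsf{leaf}=0$, $\#(\mathsf{node}\,t\,a\,u)=\#t+\#u+1$; rank $\dag\mathsf{leaf}=0$, $\dag(\mathsf{node}\,t\,a\,u)=\dag u+1$. A *predicate* $p(\vec x)$ is either $\top$ or $m\,x_i\circ m\,x_j$ with $m\in\{\#,\dag\}$, $x_i,x_j\in\vec x$ and $\circ\in\{<,\le,>,\ge,=\}$. A *refinement* of a type $\alpha$ attaches to every constructor $\mathsf{c}$ a predicate $p_{\alpha,\mathsf{c}}(\vec x)$ on its arguments $\vec x$; the refinement is again a type, its values are the values $\mathsf{c}\,\vec v$ such that $p_{\alpha,\mathsf{c}}(\vec v)$ holds and recursive arguments are again values of the refined type (in the constructor types, recursive occurrences of the type are replaced by the refined type). An unrefined type has $p_{\alpha,\mathsf{c}}=\top$ for all constructors. **Expressions.** $e ::= x \mid v\mid \mathsf{c}\,\vec x \mid \mathsf{error}\mid f\,x_1\dots x_n \mid e^{\checkmark a} \mid e_1\circ e_2 \mid \mathsf{if}\ e_1\ \mathsf{then}\ e_2\ \mathsf{else}\ e_3 \mid \mathsf{match}\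 x\ \mathsf{with}\ \{\mid \mathsf{c}_i\,\vec x_i\to e_i\} \mid \mathsf{let}\ x=e_1\ \mathsf{in}\ e_2$, where $e^{\checkmark a}$ (''tick'', $a\in\mathbb{Q}_{\ge0}$) charges cost $a$. A program $P$ is a finite set of first-order, possibly mutually recursive, function definitions $f(\vec y)=e$. Comparison operands are variables, or $\#x$, $\dag x$ (built-in functions weight and rank). Variables bound by let and match are fresh. **Big-step cost semantics** $\sigma\vdash^{c}e\Rightarrow v$ ($\sigma$ maps variables to values): $\sigma\vdash^0 x\Rightarrow\sigma(x)$; $\sigma\vdash^0\mathsf{c}\,\vec x\Rightarrow\mathsf{c}\,\sigma(\vec x)$; a comparison evaluates with cost $0$ to its truth value; if $\sigma\vdash^c e\Rightarrow v$ then $\sigma\vdash^{c+a}e^{\checkmark a}\Rightarrow v$; if $f(\vec y)=e\in P$ and $\{\vec y\mapsto\sigma(\vec x)\}\vdash^c e\Rightarrow v$ then $\sigma\vdash^c f\,\vec x\Rightarrow v$; if $\sigma\vdash^{c_1}e_1\Rightarrow w$ and $\sigma[x\mapsto w]\vdash^{c_2}e_2\Rightarrow v$ then $\sigma\vdash^{c_1+c_2}\mathsf{let}\ x=e_1\ \mathsf{in}\ e_2\Rightarrow v$; if $\sigma\vdash^c e_1\Rightarrow\mathsf{true}$ and $\sigma\vdash^d e_2\Rightarrow v$ then $\sigma\vdash^{c+d}\mathsf{if}\ e_1\ \mathsf{then}\ e_2\ \mathsf{else}\ e_3\Rightarrow v$, and symmetrically with $e_3$ for $\mathsf{false}$; if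 $\sigma(x)=\mathsf{c}_i\,\vec v$ and $\sigma[\vec x_i\mapsto\vec v]\vdash^c e_i\Rightarrow v$ then $\sigma\vdash^c\mathsf{match}\ x\ \mathsf{with}\dots\Rightarrow v$. The expression $\mathsf{error}$ has no evaluation rule. **Judgements.** A typing environment $\Gamma$ is a finite map from variables to types; $\mathcal{G}$ is a set of predicates (guards), with $\top$ omitted. A *resource function* maps valuations of the relevant variables (values of the respective types) to real numbers; it may also depend on *template parameters*, free tree-valued variables not occurring in the program, and all (in)equalities between resource functions are understood for all values of the template parameters. In $\Gamma;\mathcal{G}\mid\Psi\vdash e:\alpha\mid\Phi$, $\Psi$ is a function of the variables of $\Gamma$ (written $\Psi(\Gamma)$) and $\Phi$ a function of the result value. A substitution $\sigma$ respects $\Gamma$ if $\sigma(x)$ is a value of type $\alpha$ for each $x:\alpha$ in $\Gamma$; any further variable occurring in $\mathcal{G}$ is mapped to a tree. **Typing rules.** (In)equalities between resource functions in premises are required for all valuations of the variables by values of their types. Guard sets not mentioned are passed unchanged from conclusion to premises; ''$;p$'' means that $p$ is added to the guard set (in a premise), respectively required to be present (in the conclusion of (const)). - (var) $x:\alpha\mid\Phi\vdash x:\alpha\mid\Phi$. - (const) If $p_{\alpha,\mathsf{c}}(\vec x)\Rightarrow\Psi(\vec x)=\Phi(\mathsf{c}\,\vec x)$, then $\vec x:\vec\alpha;p_{\alpha,\mathsf{c}}(\vec x)\mid\Psi\vdash\mathsf{c}\,\vec x:\alpha\mid\Phi$. - (match) If for all $i$: $p_{\alpha,\mathsf{c}_i}(\vec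 x_i)\Rightarrow\Psi_i(\Gamma,\vec x_i)=\Psi(\Gamma,\mathsf{c}_i\,\vec x_i)$ and $\Gamma,\vec x_i:\vec\alpha_i;p_{\alpha,\mathsf{c}_i}(\vec x_i)\mid\Psi_i\vdash e_i:\beta\mid\Phi$, then $\Gamma,x:\alpha\mid\Psi\vdash\mathsf{match}\ x\ \mathsf{with}\ \{\mid\mathsf{c}_i\,\vec x_i\to e_i\}:\beta\mid\Phi$. - (ite) If $\Gamma\mid\Psi_1\vdash e_1:\mathsf{Bool}\mid0$, $\Gamma;\langle e_1\rangle\mid\Psi_2\vdash e_2:\alpha\mid\Phi$ and $\Gamma;\langle\neg e_1\rangle\mid\Psi_2\vdash e_3:\alpha\mid\Phi$, then $\Gamma\mid\Psi_1+\Psi_2\vdash\mathsf{if}\ e_1\ \mathsf{then}\ e_2\ \mathsf{else}\ e_3:\alpha\mid\Phi$. Here $\langle p\rangle$ is $p$ if it is a predicate of the grammar above, and $\top$ otherwise. Comparisons are typed $\Gamma\mid0\vdash e_1\circ e_2:\mathsf{Bool}\mid0$. - (let) If $\Psi(\Gamma,\Delta)=\Psi_1(\Gamma)+\Psi_\Delta(\Delta)+\Psi_{\mathrm{mix}}(\Gamma,\Delta)$; $\Psi_2(x,\Delta)=\Phi_1(x)+\Psi_\Delta(\Delta)+\Omega(x,\Delta)$; $\Gamma\mid\Psi_1\vdash e_1:\alpha\mid\Phi_1$; $\Delta,x:\alpha\mid\Psi_2\vdash e_2:\beta\mid\Phi$; there is a finite family of cost-free judgements $\Gamma\mid\Psi^i\vdash^{\mathrm{cf}}e_1:\alpha\mid\Phi^i$;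 and for all valuations of $\Gamma,\Delta,x$, if $\Psi^i(\Gamma)\ge\Phi^i(x)$ for all $i$ (for all template parameters) then $\Psi_{\mathrm{mix}}(\Gamma,\Delta)\ge\Omega(x,\Delta)$; then $\Gamma,\Delta\mid\Psi\vdash\mathsf{let}\ x=e_1\ \mathsf{in}\ e_2:\beta\mid\Phi$. - (app) If $(\vec y:\vec\alpha\mid\Psi\to\beta\mid\Phi)\in\mathcal{F}(f)$, $(\vec y:\vec\alpha\mid\Psi_{\mathrm{cf}}\to\beta\mid\Phi_{\mathrm{cf}})\in\mathcal{F}^{\mathrm{cf}}(f)$ and $k\in\mathbb{Q}_{\ge0}$, then $\vec x:\vec\alpha\mid\Psi+k\Psi_{\mathrm{cf}}\vdash f\,\vec x:\beta\mid\Phi+k\Phi_{\mathrm{cf}}$ (the case $k=0$ needs no cost-free signature). - (tick) If $\Gamma\mid\Psi\vdash e:\alpha\mid\Phi$ then $\Gamma\mid\Psi\vdash e^{\checkmark a}:\alpha\mid\Phi-a$. - (weaken-var) If $\Psi(\Gamma,x:\alpha)\ge\Psi'(\Gamma)$ and $\Gamma\mid\Psi'\vdash e:\beta\mid\Phi$, then $\Gamma,x:\alpha\mid\Psi\vdash e:\beta\mid\Phi$. - (shift) If $\Gamma\mid\Psi\vdash e:\alpha\mid\Phi$ and $k\ge0$, then $\Gamma\mid\Psi+k\vdash e:\alpha\mid\Phi+k$. - (share) If $\Gamma,x:\alpha,y:\alpha\mid\Psi'\vdash e[x,y]:\beta\mid\Phi$ with $x,y$ fresh, and $\Psi'(\Gamma,x,y)=\Psi(\Gamma,z)$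 whenever $x=y=z$, then $\Gamma,z:\alpha\mid\Psi\vdash e[z,z]:\beta\mid\Phi$. - (weaken) If $\Gamma;\mathcal{G}\mid\Psi'\vdash e:\alpha\mid\Phi'$, $\bigwedge\mathcal{G}\Rightarrow\Psi'(\Gamma)\le\Psi(\Gamma)$, and $\Phi'(x)\ge\Phi(x)$ for all $x:\alpha$, then $\Gamma;\mathcal{G}\mid\Psi\vdash e:\alpha\mid\Phi$. **Cost-free judgement.** $\vdash^{\mathrm{cf}}$ is the ordinary judgement applied to the expression with all ticks erased, where both signatures used in (app) are taken from $\mathcal{F}^{\mathrm{cf}}(f)$. **Well-typed program.** $P$ is well-typed if for every $f(\vec x)=e\in P$: each $(\vec x:\vec\alpha\mid\Psi\to\beta\mid\Phi)\in\mathcal{F}(f)$ satisfies $\vec x:\vec\alpha\mid\Psi\vdash e:\beta\mid\Phi$, and each $(\vec x:\vec\alpha\mid\Psi\to\beta\mid\Phi)\in\mathcal{F}^{\mathrm{cf}}(f)$ satisfies $\vec x:\vec\alpha\mid\Psi\vdash^{\mathrm{cf}}e:\beta\mid\Phi$ (both with empty guard set). *)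

(* Defs.v *)
From mathcomp Require Import all_boot all_order all_algebra.
From mathcomp Require Import finmap interval_inference.
From mathcomp Require Import classical_sets reals.
From Stdlib Require List.

Set Implicit Arguments.
Unset Strict Implicit.
Unset Printing Implicit Defensive.

Import Order.TTheory GRing.Theory Num.Theory.

Local Open Scope fset_scope.
Local Open Scope fmap_scope.
Local Open Scope ring_scope.

Definition var := nat.
Definition fname := nat.

Inductive cmpop := Lt | Le | Gt | Ge | Eq.

(* Used at [nat] (whose canonical order is the usual one) for weights and
   ranks, and at the base type. *)
Definition cmp (d : Order.disp_t) (T : orderType d) (o : cmpop) (x y : T) : bool :=
  match o with
  | Lt => (x < y)%O
  | Le => (x <= y)%O
  | Gt => (x > y)%O
  | Ge => (x >= y)%O
  | Eq => x == y
  end.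

Inductive meas := Weight | Rank.

(* Predicates on arguments named by [I]: program variables for guards,
   argument positions for the refinement of a constructor. *)
Inductive guard (I : Type) :=
| GTop
| GCmp of meas & cmpop & I & I.
Arguments GTop {I}.

Definition gmap (I J : Type) (h : I -> J) (g : guard I) : guard J :=
  if g is GCmp m o i j then GCmp m o (h i) (h j) else GTop.

Definition gvars (g : guard var) : seq var :=
  if g is GCmp _ _ x y then [:: x; y] else [::].

Inductive dtype := DBool | DTree.

Inductive con : dtype -> Type :=
| Ctrue : con DBool
| Cfalse : con DBool
| Cleaf : con DTree
| Cnode : con DTree.

Definition arity (d : dtype) (c : con d) : nat :=
  match c with Cnode => 3 | _ => 0 end.

(* Refining a refined type replaces its predicates, so one layer suffices: a
   type is the base type, or a data type together with the predicate that
   its refinement attaches to each constructor. *)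
Inductive ty :=
| TyBase
| TyData (d : dtype) of (forall c : con d, guard 'I_(arity c)).

Definition TyBool : ty := @TyData DBool (fun _ => GTop).

(* The argument types of a constructor of the refined type: the recursive
   occurrences are refined by the same predicates. *)
Definition arg_tys (d : dtype) (p : forall c : con d, guard 'I_(arity c))
    (c : con d) : (arity c).-tuple ty :=
  match c as c0 in con d0
    return (forall c : con d0, guard 'I_(arity c)) -> (arity c0).-tuple ty with
  | Cnode => fun p => [tuple TyData p; TyBase; TyData p]
  | _ => fun _ => [tuple]
  end p.

Notation ctx := {fmap var -> ty}.

(* The environment mapping the i-th variable of [xs] to the i-th item of [s];
   only used with [xs] duplicate free and of the same length as [s]. *)
Definition mkenv (A : Type) (xs : seq var) (s : seq A) : {fmap var -> A} :=
  foldr (fun xa f => f.[xa.1 <- xa.2]) [fmap] (zip xs s).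

Definition guards := set (guard var).

Definition gadd (g : guard var) (G : guards) : guards :=
  if g is GTop then G else (g |` G)%classic.

Definition gfresh (x : var) (G : guards) : Prop :=
  forall g, G g -> x \notin gvars g.

Section Language.
Variables (disp : Order.disp_t) (B : orderType disp).

Inductive tree := Leaf | Node of tree & B & tree.

Fixpoint weight (t : tree) : nat :=
  if t is Node l _ r then (weight l + weight r + 1)%N else 0%N.

Fixpoint rank (t : tree) : nat :=
  if t is Node _ _ r then (rank r + 1)%N else 0%N.

Definition measure (m : meas) (t : tree) : nat :=
  match m with Weight => weight t | Rank => rank t end.

Inductive value := VBool of bool | VBase of B | VTree of tree.

(* [None] on arguments that are not of the argument types. *)
Definition con_val (d : dtype) (c : con d) (vs : seq value) : option value :=
  match c, vs with
  | Ctrue, [::] => Some (VBool true)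
  | Cfalse, [::] => Some (VBool false)
  | Cleaf, [::] => Some (VTree Leaf)
  | Cnode, [:: VTree l; VBase a; VTree r] => Some (VTree (Node l a r))
  | _, _ => None
  end.

(* A predicate about anything that is not a tree is false. *)
Definition gholds (I : Type) (lookup : I -> option value) (g : guard I) : bool :=
  match g with
  | GTop => true
  | GCmp m o i j =>
      match lookup i, lookup j with
      | Some (VTree t), Some (VTree u) => cmp o (measure m t) (measure m u)
      | _, _ => false
      end
  end.

Inductive has_ty : value -> ty -> Prop :=
| HT_base (b : B) : has_ty (VBase b) TyBase
| HT_con (d : dtype) (p : forall c : con d, guard 'I_(arity c)) (c : con d)
    (vs : (arity c).-tuple value) (v : value) :
    con_val c vs = Some v ->
    gholds (fun i => Some (tnth vs i)) (p c) ->
    (forall i, has_ty (tnth vs i) (tnth (arg_tys p c) i)) ->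
    has_ty v (TyData p).

Definition has_tys (vs : seq value) (As : seq ty) : Prop := List.Forall2 has_ty vs As.

Inductive operand := OVar of var | OMeas of meas & var.

Inductive expr :=
| EVar of var
| EVal of value
| ECon (d : dtype) (c : con d) of (arity c).-tuple var
| EError
| EApp of fname & seq var
| ETick of expr & {nonneg rat}
| ECmp of cmpop & operand & operand
| EIf of expr & expr & expr
| EMatch (x : var) (d : dtype) (xs : forall c : con d, (arity c).-tuple var)
    (es : con d -> expr)
| ELet of var & expr & expr.

Fixpoint binds (e : expr) (x : var) : Prop :=
  match e with
  | ETick e _ => binds e x
  | EIf e1 e2 e3 => binds e1 x \/ binds e2 x \/ binds e3 x
  | EMatch _ d xs es => exists c : con d, x \in xs c \/ binds (es c) x
  | ELet y e1 e2 => x = y \/ binds e1 x \/ binds e2 x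
  | _ => False
  end.

Definition orename (h : var -> var) (a : operand) : operand :=
  match a with OVar x => OVar (h x) | OMeas m x => OMeas m (h x) end.

(* Renaming of free variables. Binders are left alone: this is only used when
   no variable moved by [h], nor any image of such a variable, is bound in the
   expression. *)
Fixpoint rename (h : var -> var) (e : expr) : expr :=
  match e with
  | EVar x => EVar (h x)
  | EVal v => EVal v
  | ECon d c xs => ECon (map_tuple h xs)
  | EError => EError
  | EApp f xs => EApp f (map h xs)
  | ETick e a => ETick (rename h e) a
  | ECmp o a b => ECmp o (orename h a) (orename h b)
  | EIf e1 e2 e3 => EIf (rename h e1) (rename h e2) (rename h e3)
  | EMatch x d xs es => EMatch (h x) xs (fun c => rename h (es c))
  | ELet x e1 e2 => ELet x (rename h e1) (rename h e2)
  end.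

Fixpoint erase (e : expr) : expr :=
  match e with
  | ETick e _ => erase e
  | EIf e1 e2 e3 => EIf (erase e1) (erase e2) (erase e3)
  | EMatch x d xs es => EMatch x xs (fun c => erase (es c))
  | ELet x e1 e2 => ELet x (erase e1) (erase e2)
  | e => e
  end.

Definition guard_of (e : expr) : guard var :=
  match e with
  | ECmp o (OMeas Weight x) (OMeas Weight y) => GCmp Weight o x y
  | ECmp o (OMeas Rank x) (OMeas Rank y) => GCmp Rank o x y
  | _ => GTop
  end.

(* The negation of an equality is not in the grammar of predicates. *)
Definition guard_of_neg (e : expr) : guard var :=
  match guard_of e with
  | GCmp m Lt x y => GCmp m Ge x y
  | GCmp m Le x y => GCmp m Gt x y
  | GCmp m Gt x y => GCmp m Le x y
  | GCmp m Ge x y => GCmp m Lt x y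
  | _ => GTop
  end.

Definition program := {fmap fname -> seq var * expr}.

Notation subst := {fmap var -> value}.

(* Weights and ranks are compared with each other, and base values with base
   values; other comparisons have no truth value. *)
Definition cmp_val (s : subst) (o : cmpop) (a b : operand) : option bool :=
  match a, b with
  | OVar x, OVar y =>
      match s.[? x], s.[? y] with
      | Some (VBase u), Some (VBase w) => Some (cmp o u w)
      | _, _ => None
      end
  | OMeas m x, OMeas n y =>
      match s.[? x], s.[? y] with
      | Some (VTree t), Some (VTree u) => Some (cmp o (measure m t) (measure n u))
      | _, _ => None
      end
  | _, _ => None
  end.

(* In [s + t] the right operand takes precedence. *)
Inductive eval (P : program) : subst -> expr -> rat -> value -> Prop :=
| E_var (s : subst) x v : s.[? x] = Some v -> eval P s (EVar x) 0 v
| E_val (s : subst) v : eval P s (EVal v) 0 v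
| E_con (s : subst) d (c : con d) (xs : (arity c).-tuple var) vs v :
    [seq s.[? x] | x <- xs] = [seq Some w | w <- vs] ->
    con_val c vs = Some v ->
    eval P s (ECon xs) 0 v
| E_cmp (s : subst) o a b r : cmp_val s o a b = Some r -> eval P s (ECmp o a b) 0 (VBool r)
| E_tick (s : subst) e (a : {nonneg rat}) c v :
    eval P s e c v -> eval P s (ETick e a) (c + a%:num) v
| E_app (s : subst) f xs ys e vs c v :
    P.[? f] = Some (ys, e) ->
    size ys = size xs ->
    [seq s.[? x] | x <- xs] = [seq Some w | w <- vs] ->
    eval P (mkenv ys vs) e c v ->
    eval P s (EApp f xs) c v
| E_let (s : subst) x e1 e2 c1 c2 w v :
    eval P s e1 c1 w ->
    eval P s.[x <- w] e2 c2 v ->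
    eval P s (ELet x e1 e2) (c1 + c2) v
| E_if_true (s : subst) e1 e2 e3 c1 c2 v :
    eval P s e1 c1 (VBool true) ->
    eval P s e2 c2 v ->
    eval P s (EIf e1 e2 e3) (c1 + c2) v
| E_if_false (s : subst) e1 e2 e3 c1 c2 v :
    eval P s e1 c1 (VBool false) ->
    eval P s e3 c2 v ->
    eval P s (EIf e1 e2 e3) (c1 + c2) v
| E_match (s : subst) x d (xs : forall c : con d, (arity c).-tuple var) es (i : con d) vs w c v :
    s.[? x] = Some w ->
    con_val i vs = Some w ->
    eval P (s + mkenv (xs i) vs)%fset (es i) c v ->
    eval P s (EMatch x xs es) c v.

Definition respects (Gam : ctx) (s : subst) : Prop :=
  forall x A, Gam.[? x] = Some A -> exists2 v, s.[? x] = Some v & has_ty v A.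

Definition respects_guards (Gam : ctx) (G : guards) (s : subst) : Prop :=
  forall g x, G g -> x \in gvars g -> x \notin domf Gam ->
    exists t, s.[? x] = Some (VTree t).

Definition guards_true (G : guards) (s : subst) : Prop :=
  forall g, G g -> gholds (fun x => s.[? x]) g.

Definition valuation (Gam : ctx) (r : subst) : Prop :=
  domf r = domf Gam /\ respects Gam r.

Section Typing.
Variable R : realType.

(* Valuations of the template parameters, which are named by [nat]
   independently of program variables. *)
Definition template := nat -> tree.

(* [rfun] is used for functions of the result, [rfun_env] for functions of the
   variables of an environment: all rules constrain the latter on valuations
   of that environment only. *)
Definition rfun := template -> value -> R.
Definition rfun_env := template -> subst -> R.
Definition rfun_args := template -> seq value -> R.

Definition named (xs : seq var) (f : rfun_args) : rfun_env :=
  fun t r => f t (pmap (fun x => r.[? x]) xs).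

Record signature := Signature {
  sig_args : seq ty;
  sig_pre : rfun_args;
  sig_res : ty;
  sig_post : rfun }.

Definition sigs := fname -> set signature.

Definition fresh (x : var) (Gam : ctx) (G : guards) : Prop :=
  x \notin domf Gam /\ gfresh x G.

(* The convention that bound variables are fresh is a side condition of
   [T_match], [T_let] and [T_share]. Environments are affine: an argument list
   with repetitions is obtained from a duplicate-free one by [T_share].
   [F] provides the first signature and [Fcf] the second, cost-free one in
   applications; the cost-free judgement is [typed Fcf Fcf] on an erased
   expression. *)
Inductive typed (Fcf : sigs) :
    sigs -> ctx -> guards -> rfun_env -> expr -> ty -> rfun -> Prop :=
| T_var (F : sigs) G x A (Psi : rfun_env) (Phi : rfun) :
    (forall t v, has_ty v A -> Psi t [fmap].[x <- v] = Phi t v) ->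
    typed Fcf F [fmap].[x <- A] G Psi (EVar x) A Phi
| T_const (F : sigs) G d (p : forall c : con d, guard 'I_(arity c)) (c : con d)
    (xs : (arity c).-tuple var) (Psi : rfun_env) (Phi : rfun) :
    uniq xs ->
    p c = GTop \/ G (gmap (tnth xs) (p c)) ->
    (forall t (vs : (arity c).-tuple value) v,
       has_tys vs (arg_tys p c) -> gholds (fun i => Some (tnth vs i)) (p c) ->
       con_val c vs = Some v ->
       Psi t (mkenv xs vs) = Phi t v) ->
    typed Fcf F (mkenv xs (arg_tys p c)) G Psi (ECon xs) (TyData p) Phi
| T_match (F : sigs) (Gam : ctx) G x d (p : forall c : con d, guard 'I_(arity c))
    (xs : forall c : con d, (arity c).-tuple var) es A
    (Psi : rfun_env) (Psis : con d -> rfun_env) (Phi : rfun) :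
    x \notin domf Gam ->
    (forall c, uniq (xs c)) ->
    (forall c y, y \in xs c -> y <> x /\ fresh y Gam G) ->
    (forall c t r (vs : (arity c).-tuple value) v,
       valuation Gam r -> has_tys vs (arg_tys p c) ->
       gholds (fun i => Some (tnth vs i)) (p c) -> con_val c vs = Some v ->
       Psis c t (r + mkenv (xs c) vs)%fset = Psi t r.[x <- v]) ->
    (forall c, typed Fcf F (Gam + mkenv (xs c) (arg_tys p c))%fset
       (gadd (gmap (tnth (xs c)) (p c)) G) (Psis c) (es c) A Phi) ->
    typed Fcf F Gam.[x <- TyData p] G Psi (EMatch x xs es) A Phi
| T_cmp (F : sigs) Gam G o a b :
    typed Fcf F Gam G (fun _ _ => 0) (ECmp o a b) TyBool (fun _ _ => 0)
| T_ite (F : sigs) Gam G e1 e2 e3 A (Psi1 Psi2 : rfun_env) (Phi : rfun) :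
    typed Fcf F Gam G Psi1 e1 TyBool (fun _ _ => 0) ->
    typed Fcf F Gam (gadd (guard_of e1) G) Psi2 e2 A Phi ->
    typed Fcf F Gam (gadd (guard_of_neg e1) G) Psi2 e3 A Phi ->
    typed Fcf F Gam G (fun t r => Psi1 t r + Psi2 t r) (EIf e1 e2 e3) A Phi
| T_let (F : sigs) (Gam Del : ctx) G x e1 e2 A C
    (Psi Psi1 PsiD Psimix Psi2 Omega : rfun_env) (Phi1 Phi : rfun)
    (n : nat) (Psis : 'I_n -> rfun_env) (Phis : 'I_n -> rfun) :
    [disjoint domf Gam & domf Del] ->
    fresh x (Gam + Del)%fset G ->
    (forall t r q, valuation Gam r -> valuation Del q ->
       Psi t (r + q)%fset = Psi1 t r + PsiD t q + Psimix t (r + q)%fset) ->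
    (forall t q v, valuation Del q -> has_ty v A ->
       Psi2 t q.[x <- v] = Phi1 t v + PsiD t q + Omega t q.[x <- v]) ->
    typed Fcf F Gam G Psi1 e1 A Phi1 ->
    typed Fcf F Del.[x <- A] G Psi2 e2 C Phi ->
    (forall i, typed Fcf Fcf Gam G (Psis i) (erase e1) A (Phis i)) ->
    (forall r q v, valuation Gam r -> valuation Del q -> has_ty v A ->
       (forall i t, Psis i t r >= Phis i t v) ->
       forall t, Psimix t (r + q)%fset >= Omega t q.[x <- v]) ->
    typed Fcf F (Gam + Del)%fset G Psi (ELet x e1 e2) C Phi
| T_app0 (F : sigs) G f xs (s : signature) :
    F f s ->
    uniq xs -> size xs = size (sig_args s) ->
    typed Fcf F (mkenv xs (sig_args s)) G (named xs (sig_pre s)) (EApp f xs)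
      (sig_res s) (sig_post s)
| T_app (F : sigs) G f xs (s s' : signature) (k : {nonneg rat}) :
    F f s -> Fcf f s' ->
    sig_args s' = sig_args s -> sig_res s' = sig_res s ->
    uniq xs -> size xs = size (sig_args s) ->
    typed Fcf F (mkenv xs (sig_args s)) G
      (fun t r => named xs (sig_pre s) t r + ratr k%:num * named xs (sig_pre s') t r)
      (EApp f xs) (sig_res s)
      (fun t v => sig_post s t v + ratr k%:num * sig_post s' t v)
| T_tick (F : sigs) Gam G e (a : {nonneg rat}) A (Psi : rfun_env) (Phi : rfun) :
    typed Fcf F Gam G Psi e A Phi ->
    typed Fcf F Gam G Psi (ETick e a) A (fun t v => Phi t v - ratr a%:num)
| T_weaken_var (F : sigs) (Gam : ctx) G x A e C (Psi Psi' : rfun_env) (Phi : rfun) :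
    x \notin domf Gam ->
    (forall t r v, valuation Gam r -> has_ty v A -> Psi t r.[x <- v] >= Psi' t r) ->
    typed Fcf F Gam G Psi' e C Phi ->
    typed Fcf F Gam.[x <- A] G Psi e C Phi
| T_shift (F : sigs) Gam G e A (Psi : rfun_env) (Phi : rfun) (k : R) :
    0 <= k ->
    typed Fcf F Gam G Psi e A Phi ->
    typed Fcf F Gam G (fun t r => Psi t r + k) e A (fun t v => Phi t v + k)
| T_share (F : sigs) (Gam : ctx) G x y z A e C (Psi Psi' : rfun_env) (Phi : rfun) :
    x <> y -> x <> z -> y <> z ->
    fresh x Gam G -> fresh y Gam G -> z \notin domf Gam ->
    ~ binds e x -> ~ binds e y -> ~ binds e z ->
    (forall t r v, valuation Gam r -> has_ty v A ->
       Psi' t r.[x <- v].[y <- v] = Psi t r.[z <- v]) ->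
    typed Fcf F Gam.[x <- A].[y <- A] G Psi' e C Phi ->
    typed Fcf F Gam.[z <- A] G Psi
      (rename (fun w => if (w == x) || (w == y) then z else w) e) C Phi
| T_weaken (F : sigs) Gam G e A (Psi Psi' : rfun_env) (Phi Phi' : rfun) :
    typed Fcf F Gam G Psi' e A Phi' ->
    (forall t s, respects Gam s -> respects_guards Gam G s -> guards_true G s ->
       Psi' t s.[& domf Gam] <= Psi t s.[& domf Gam]) ->
    (forall t v, has_ty v A -> Phi' t v >= Phi t v) ->
    typed Fcf F Gam G Psi e A Phi.

Definition typed_cf (Fcf : sigs) (Gam : ctx) (G : guards) (Psi : rfun_env)
    (e : expr) (A : ty) (Phi : rfun) : Prop :=
  typed Fcf Fcf Gam G Psi (erase e) A Phi.

Definition well_typed (P : program) (F Fcf : sigs) : Prop :=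
  forall f xs e, P.[? f] = Some (xs, e) ->
    [/\ uniq xs,
        forall s, F f s -> size xs = size (sig_args s) /\
          typed Fcf F (mkenv xs (sig_args s)) set0 (named xs (sig_pre s)) e
            (sig_res s) (sig_post s)
      & forall s, Fcf f s -> size xs = size (sig_args s) /\
          typed_cf Fcf (mkenv xs (sig_args s)) set0 (named xs (sig_pre s)) e
            (sig_res s) (sig_post s)].

End Typing.
End Language.

Notation subst B := {fmap var -> value B}.

Arguments Leaf {disp B}.
Arguments VBool {disp B} _.
Arguments EVar {disp B} _.
Arguments ECon {disp B d c} _.
Arguments EError {disp B}.
Arguments EApp {disp B} _ _.
Arguments ECmp {disp B} _ _ _.

(* Main.v *)
(* Function calls are interpreted by a parameter, so that the semantics of an
   expression is a recursion on its syntax and soundness goes by induction on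
   the typing derivation alone: the cost-free premises of (let) and the
   renamings of (share) are then subderivations like any other. The parameter
   is chosen to relate a call to a result exactly when that call satisfies all
   its signatures. Induction on the evaluation shows that every evaluation is
   one of this semantics: at a call, soundness of typing applied to the function
   body gives the signatures. *)

Require Import Defs.
From mathcomp Require Import all_boot all_order all_algebra.
From mathcomp Require Import finmap interval_inference.
From mathcomp Require Import classical_sets reals.
From Stdlib Require Eqdep_dec.
From mathcomp Require Import lra.
Set Implicit Arguments.
Unset Strict Implicit.
Unset Printing Implicit Defensive.
Import Order.TTheory GRing.Theory Num.Theory.
Local Open Scope fset_scope.
Local Open Scope fmap_scope.
Local Open Scope ring_scope.

(** * Finite environments: lookup, restriction, update and concatenation *)

Section Environments.
Variable A : Type.
Implicit Types (s : {fmap var -> A}) (xs : seq var) (vs : seq A).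

Lemma mem_mkenv (C : Type) xs (vs : seq C) x : size xs = size vs ->
  (x \in domf (mkenv xs vs)) = (x \in xs).
Proof.
elim: xs vs => [|y xs IH] [|w vs] //= [/IH {}IH].
by rewrite in_fset1U in_cons IH.
Qed.

Lemma size_lookup s xs vs :
  [seq s.[? x] | x <- xs] = [seq Some w | w <- vs] -> size xs = size vs.
Proof. by move/(congr1 size); rewrite !size_map. Qed.

(** Repetitions in [xs] are harmless: the values are read off [s], so a repeated variable is always
    paired with the same value. *)
Lemma fnd_mkenv s xs vs x :
  [seq s.[? x] | x <- xs] = [seq Some w | w <- vs] ->
  (mkenv xs vs).[? x] = if x \in xs then s.[? x] else None.
Proof.
elim: xs vs => [|y xs IH] [|w vs] //= => [_|[ys /IH {}IH]].
  by rewrite fnd_fmap0.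
by rewrite fnd_set inE IH; case: eqP => // ->.
Qed.

(** Brings an environment built by [mkenv] under the lookup equation by which [eval] describes
    argument lists and on which the other lemmas about [mkenv] rest. *)
Lemma mkenv_lookup xs vs : uniq xs -> size xs = size vs ->
  [seq (mkenv xs vs).[? x] | x <- xs] = [seq Some w | w <- vs].
Proof.
elim: xs vs => [|y xs IH] [|w vs] //= /andP[yxs uxs] [/(IH _ uxs) <-].
rewrite fnd_set eqxx; congr cons; apply/eq_in_map => x xxs.
by rewrite fnd_set; case: eqP xxs yxs => // -> ->.
Qed.

Lemma mkenv_tnth n (xs : n.-tuple var) (vs : n.-tuple A) s i :
  [seq s.[? x] | x <- xs] = [seq Some w | w <- vs] ->
  s.[? tnth xs i] = Some (tnth vs i).
Proof.
move=> e; have := congr1 (fun l => nth None l i) e.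
rewrite (nth_map (tnth xs i)) ?size_tuple // (nth_map (tnth vs i)) ?size_tuple //.
by rewrite -!tnth_nth.
Qed.

Lemma restrict_mkenv (C : Type) (Cs : seq C) s xs vs :
  size xs = size Cs ->
  [seq s.[? x] | x <- xs] = [seq Some w | w <- vs] ->
  s.[& domf (mkenv xs Cs)] = mkenv xs vs.
Proof.
move=> sz e; apply/fmapP => x.
by rewrite fnd_restrict (fnd_mkenv _ e) mem_mkenv.
Qed.

Lemma pmap_lookup (f : var -> option A) xs vs :
  [seq f x | x <- xs] = [seq Some w | w <- vs] -> pmap f xs = vs.
Proof. by elim: xs vs => [|x xs IH] [|v vs] //= [-> /IH ->]. Qed.

Lemma restrict_set (C : Type) (f : {fmap var -> C}) s x c w :
  s.[? x] = Some w -> s.[& domf f.[x <- c]] = s.[& domf f].[x <- w].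
Proof.
move=> sx; apply/fmapP => y.
by rewrite fnd_set !fnd_restrict mem_setf !inE; case: eqP => //= ->.
Qed.

Lemma restrict_set2 (C : Type) (f : {fmap var -> C}) s x c w :
  s.[x <- w].[& domf f.[x <- c]] = s.[& domf f].[x <- w].
Proof.
apply/fmapP => y.
by rewrite !(fnd_set, fnd_restrict) mem_setf !inE; case: eqP.
Qed.

Lemma restrict_cat (C : Type) (f g : {fmap var -> C}) s :
  domf g `<=` domf s ->
  s.[& domf (f + g)%fset] = (s.[& domf f] + s.[& domf g])%fset.
Proof.
move=> /fsubsetP gs; apply/fmapP => y.
rewrite fnd_cat !fnd_restrict mem_catf mem_restrictf.
case: (boolP (y \in g)) => [yg|_]; rewrite ?orbF ?orbT //=.
by rewrite (gs _ yg).
Qed.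

Lemma eq_restrict (C : Type) (f : {fmap var -> C}) (s s' : {fmap var -> A}) :
  (forall x, x \in domf f -> s.[? x] = s'.[? x]) ->
  s.[& domf f] = s'.[& domf f].
Proof. by move=> e; apply/fmapP => y; rewrite !fnd_restrict; case: ifP => [/e|]. Qed.

End Environments.

Section Soundness.
Variables (disp : Order.disp_t) (B : orderType disp).
Implicit Types (s : subst B) (v w : value B) (vs : seq (value B)).
Implicit Types (Gam Del : ctx) (G : guards).

(** * Guards and typing environments under changes of the substitution *)

Lemma gholds_gmap (I J : Type) (h : I -> J) (look : J -> option (value B)) g :
  gholds look (gmap h g) = gholds (fun i => look (h i)) g.
Proof. by case: g. Qed.

Lemma eq_gholds (I : eqType) (look look' : I -> option (value B)) g :
  (forall i, look i = look' i) -> gholds look g = gholds look' g.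
Proof. by move=> e; case: g => //= m o i j; rewrite !e. Qed.

Lemma gholds_eq_in s s' g :
  (forall x, x \in gvars g -> s.[? x] = s'.[? x]) ->
  gholds (fun x => s.[? x]) g = gholds (fun x => s'.[? x]) g.
Proof.
by case: g => //= m o x y e; rewrite !e // !inE eqxx ?orbT.
Qed.

(** A predicate about a non-tree counts as false, so a true guard forces its variables to be trees.
    This supplies a premise of the (weaken) inequality. *)
Lemma respects_guards_true Gam G s : guards_true G s -> respects_guards Gam G s.
Proof.
move=> Gs [|m o x y] z /Gs //=.
case sx: (s.[? x]) => [[?|?|t]|] //; case sy: (s.[? y]) => [[?|?|u]|] // _.
by rewrite !inE => /orP[] /eqP -> _; [exists t|exists u].
Qed.

Lemma guards_true_gadd g G s :
  gholds (fun x => s.[? x]) g -> guards_true G s -> guards_true (gadd g G) s.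
Proof. by case: g => //= m o x y gs Gs g [->|/Gs]. Qed.

(** Serves the rules that introduce variables: [D] collects the fresh ones, and since no guard
    mentions them, no guard notices their new values. *)
Lemma guards_true_fresh G s s' (D : {pred var}) :
  (forall x, x \in D -> gfresh x G) ->
  (forall x, x \notin D -> s.[? x] = s'.[? x]) ->
  guards_true G s -> guards_true G s'.
Proof.
move=> Dfr e Gs g Gg; rewrite -(@gholds_eq_in s) ?Gs // => x xg.
by apply: e; apply/negP => /Dfr /(_ g Gg); rewrite xg.
Qed.

Lemma respects_valuation Gam s : respects Gam s -> valuation Gam s.[& domf Gam].
Proof.
move=> Gs; split.
  apply/fsetP => x; rewrite mem_restrictf; case: fndP => //= xG.
  by case: (Gs _ _ (in_fnd xG)) => v; case: fndP.
move=> x A xA; case: (Gs _ _ xA) => v sx vA; exists v => //.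
by rewrite fnd_restrict; case: fndP xA.
Qed.

Lemma respects_dom Gam s : respects Gam s -> domf Gam `<=` domf s.
Proof.
move=> Gs; apply/fsubsetP => x xG.
by case: (Gs _ _ (in_fnd xG)) => v; case: fndP.
Qed.

Lemma eq_respects Gam s s' : (forall x, x \in domf Gam -> s.[? x] = s'.[? x]) ->
  respects Gam s -> respects Gam s'.
Proof.
move=> e Gs x A xA; case: (Gs _ _ xA) => v sx vA; exists v => //.
by rewrite -e //; case: fndP xA.
Qed.

Lemma respects_set Gam s x A : x \notin domf Gam ->
  respects Gam.[x <- A] s <->
  respects Gam s /\ exists2 v, s.[? x] = Some v & has_ty v A.
Proof.
move=> xG; split=> [Gs|[Gs xs] y C].
  split=> [y C yC|]; apply: Gs; rewrite fnd_set ?eqxx //.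
  by case: eqP yC => // ->; rewrite not_fnd.
by rewrite fnd_set; case: eqP => [-> [<-]|_ /Gs].
Qed.

Lemma respects_catl Gam Del s : [disjoint domf Gam & domf Del] ->
  respects (Gam + Del)%fset s -> respects Gam s.
Proof.
move=> /fdisjointP dis Gs x A xA; apply: Gs; rewrite fnd_cat.
case: ifPn => // xD; case: fndP xA => // xG. by move: (dis _ xG); rewrite xD.
Qed.

Lemma respects_catr Gam Del s : respects (Gam + Del)%fset s -> respects Del s.
Proof.
by move=> Gs x A xA; apply: Gs; rewrite fnd_cat; case: fndP xA.
Qed.

(** * Typed argument lists, constructor values and comparisons *)

Lemma has_tys_tnth n (vs : n.-tuple (value B)) (As : n.-tuple ty) :
  (forall i, has_ty (tnth vs i) (tnth As i)) -> has_tys vs As.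
Proof.
case: vs As => [vs szv] [As szA] /=; elim: n vs szv As szA => [|n IH].
  by case=> // ? [] // *; constructor.
case=> //= v vs szv [] //= A As szA h; constructor; first exact: (h ord0).
apply: (IH vs szv As szA) => i; have := h (lift ord0 i).
by rewrite !(tnth_nth (VBool true)) !(tnth_nth TyBase).
Qed.

Lemma has_tys_nth n (vs : n.-tuple (value B)) (As : n.-tuple ty) i :
  has_tys vs As -> has_ty (tnth vs i) (tnth As i).
Proof.
rewrite !(tnth_nth (VBool true)) !(tnth_nth TyBase) => h.
have := ltn_ord i; rewrite -[X in (_ < X)%N](size_tuple vs).
by elim: h (nat_of_ord i) => //= ? ? ? ? ? _ IH [|j] //= /IH.
Qed.

Lemma respects_mkenv xs vs As : size xs = size As -> has_tys vs As ->
  respects (mkenv xs As) (mkenv xs vs).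
Proof.
move=> + h; elim: h xs => {vs As} [|v A vs As vA _ IH] [|x xs] //=.
  by move=> _ y A; rewrite fnd_fmap0.
case=> /IH {}IH y C; rewrite !fnd_set; case: eqP => [_ [<-]|_ /IH] //.
by exists v.
Qed.

Lemma mkenv_has_tys xs vs As s : uniq xs -> size xs = size As ->
  [seq s.[? x] | x <- xs] = [seq Some w | w <- vs] ->
  respects (mkenv xs As) s -> has_tys vs As.
Proof.
elim: xs vs As => [|x xs IH] [|v vs] [|A As] //=; first by constructor.
move=> /andP[xxs uxs] [sz] [sx e].
rewrite respects_set; last by rewrite mem_mkenv.
rewrite sx => -[/(IH _ _ uxs sz e) vA [_ [<-]]]; by constructor.
Qed.

(** The match on [A] lets case analysis instantiate the refinement directly, without an equation
    between dependent pairs. *)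
Lemma has_ty_inv v A : has_ty v A ->
  match A with
  | TyBase => True
  | TyData d p => exists c : con d, exists vs : (arity c).-tuple (value B),
      [/\ con_val c vs = Some v, gholds (fun i => Some (tnth vs i)) (p c)
        & has_tys vs (arg_tys p c)]
  end.
Proof.
case=> // d p c vs {}v cv gv /has_tys_tnth vA.
by exists c, vs.
Qed.

Lemma con_val_inj d (c c' : con d) vs vs' v :
  con_val c vs = Some v -> con_val c' vs' = Some v -> c = c' /\ vs = vs'.
Proof.
(* The data types of the two constructors are made independent so that both can be analysed by
   cases; the constructors are then compared as dependent pairs. *)
have gen d' (k' : con d') d0 (k : con d0) : con_val k vs = Some v ->
    con_val k' vs' = Some v -> existT con d0 k = existT con d' k' /\ vs = vs'.
  case: k => /=; case: vs => [|[?|?|?] [|[?|?|?] [|[?|?|?] []]]] //= [<-];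
  case: k' => /=; case: vs' => [|[?|?|?] [|[?|?|?] [|[?|?|?] []]]] //= [] //;
  by move=> -> -> ->.
move=> h h'; have [e ->] := gen _ _ _ _ h h'; split=> //.
(* Equality on [dtype] is decidable, so equal dependent pairs have equal second components. *)
by apply: Eqdep_dec.inj_pair2_eq_dec e; decide equality.
Qed.

Lemma con_val_size d (c : con d) vs v : con_val c vs = Some v -> size vs = arity c.
Proof. by case: c => /=; case: vs => [|[?|?|?] [|[?|?|?] [|[?|?|?] []]]]. Qed.

(** A value decomposes uniquely into constructor and arguments, so the decomposition witnessing its
    type is the one that a match selects. *)
Lemma has_ty_con d (p : forall c : con d, guard 'I_(arity c)) (c : con d)
    (vs : (arity c).-tuple (value B)) v :
  has_ty v (TyData p) -> con_val c vs = Some v ->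
  gholds (fun i => Some (tnth vs i)) (p c) /\ has_tys vs (arg_tys p c).
Proof.
move=> /has_ty_inv[c' [vs' [cv' gv' vA']]] cv.
have [E Evs] := con_val_inj cv cv'; case: c' / E in vs' cv' gv' vA' Evs *.
by rewrite (val_inj Evs).
Qed.

Lemma cmp_guard s o a b : cmp_val s o a b = Some true ->
  gholds (fun x => s.[? x]) (guard_of (ECmp (B := B) o a b)).
Proof.
case: a b => [?|m x] [?|n y] //=; case: m n => -[] //=;
by case: (s.[? x]) => // -[] // ?; case: (s.[? y]) => // -[] // ? [].
Qed.

(** The order is total, so a failed inequality gives the converse one; a failed equality contributes
    only [GTop]. *)
Lemma cmp_guard_neg s o a b : cmp_val s o a b = Some false ->
  gholds (fun x => s.[? x]) (guard_of_neg (ECmp (B := B) o a b)).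
Proof.
rewrite /guard_of_neg; case: a b => [?|m x] [?|n y] //=; case: m n o => -[] [] //=;
case: (s.[? x]) => // -[] // ?; case: (s.[? y]) => // -[] // ? [] /=;
by move/negbT; rewrite -?ltNge -?leNgt.
Qed.

(** * The recursive semantics, its renaming and its erasure *)

Section Run.
Variable call : fname -> seq (value B) -> rat -> value B -> Prop.

Fixpoint run s (e : expr B) (c : rat) (v : value B) : Prop :=
  match e with
  | EVar x => c = 0 /\ s.[? x] = Some v
  | EVal w => c = 0 /\ w = v
  | ECon d k xs => c = 0 /\ exists2 vs,
      [seq s.[? x] | x <- xs] = [seq Some w | w <- vs] & con_val k vs = Some v
  | EError => False
  | EApp f xs => exists2 vs,
      [seq s.[? x] | x <- xs] = [seq Some w | w <- vs] & call f vs c v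
  | ETick e a => exists2 c', c = c' + a%:num & run s e c' v
  | ECmp o a b => c = 0 /\ exists2 r, cmp_val s o a b = Some r & v = VBool r
  | EIf e1 e2 e3 => exists c1 c2 (b : bool), [/\ c = c1 + c2,
      run s e1 c1 (VBool b) & if b then run s e2 c2 v else run s e3 c2 v]
  | EMatch x d xs es => exists (k : con d) vs w, [/\ s.[? x] = Some w,
      con_val k vs = Some w & run (s + mkenv (xs k) vs)%fset (es k) c v]
  | ELet x e1 e2 => exists c1 c2 w, [/\ c = c1 + c2,
      run s e1 c1 w & run s.[x <- w] e2 c2 v]
  end.

(** Only a comparison yields a guard other than [GTop], so every other condition is trivial. *)
Lemma run_guard s e c b : run s e c (VBool b) ->
  gholds (fun x => s.[? x]) (if b then guard_of e else guard_of_neg e).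
Proof.
case: e; try by case: b.
move=> o x y [_ [r h [->]]].
by case: r h => [/cmp_guard|/cmp_guard_neg].
Qed.

(* The hypothesis on [h] says that it is the identity on the variables bound in
   [e] and captures nothing. *)
Lemma run_rename (h : var -> var) e s s' c v :
  (forall x y, binds e x -> (h y == x) = (y == x)) ->
  (forall x, s'.[? x] = s.[? h x]) ->
  run s (rename h e) c v -> run s' e c v.
Proof.
have lookup (xs : seq var) (t t' : subst B) : (forall x, t'.[? x] = t.[? h x]) ->
    [seq t'.[? x] | x <- xs] = [seq t.[? x] | x <- [seq h x | x <- xs]].
  by move=> tt'; rewrite -map_comp; apply: eq_map => x /=; rewrite tt'.
elim: e s s' c v => /=.
- by move=> x s s' c v _ ->.
- by [].
- move=> d k xs s s' c v _ ss' [-> [vs e cv]]; split=> //; exists vs => //.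
  by rewrite (lookup _ _ _ ss').
- by [].
- move=> f xs s s' c v _ ss' [vs e fv]; exists vs => //.
  by rewrite (lookup _ _ _ ss').
- move=> e IH a s s' c v hb ss' [c' -> /(IH _ _ _ _ hb ss')]; by exists c'.
- move=> o a b s s' c v _ ss' [-> [r e ->]]; split=> //; exists r => //.
  by rewrite -e; case: a b {e} => [x|m x] [y|n y] //=; rewrite !ss'.
- move=> e1 IH1 e2 IH2 e3 IH3 s s' c v hb ss' [c1 [c2 [b [-> r1 r2]]]].
  exists c1, c2, b; split=> //; first by apply: IH1 r1 => // x y bx; apply: hb; left.
  case: b {r1} r2; [apply: IH2|apply: IH3] => // x y bx; apply: hb; auto.
- move=> x d xs es IH s s' c v hb ss' [k [vs [w [sx cv r]]]].
  exists k, vs, w; split=> //; first by rewrite ss'.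
  apply: IH r => [z y bz|y]; first by apply: hb; exists k; right.
  have sz : size (xs k) = size vs by rewrite (con_val_size cv) size_tuple.
rewrite !fnd_cat !mem_mkenv // ?ss'.
  case: (boolP (y \in xs k)) => yxs.
    have /eqP-> : h y == y by rewrite hb //; exists k; left.
    by rewrite yxs.
  (* If [h y] were a pattern variable, [hb] at [h y] would force [y = h y], contradicting that [y]
     is not one. *)
  case: ifPn => // hyxs; case/negP: yxs.
  suff -> : y = h y by [].
  by apply/eqP; rewrite -(hb (h y)) //; exists k; left.
- move=> x e1 IH1 e2 IH2 s s' c v hb ss' [c1 [c2 [w [-> r1 r2]]]].
  exists c1, c2, w; split=> //; first by apply: IH1 r1 => // z y bz; apply: hb; auto.
  apply: IH2 r2 => [z y bz|y]; first by apply: hb; auto.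
  by rewrite !fnd_set ss' (hb x y) //; left.
Qed.

End Run.

(** Cost arises from ticks and calls only; erasure removes the former and [free] makes the latter
    costless, while the result stays the same. *)
Lemma run_erase (call call' : fname -> seq (value B) -> rat -> value B -> Prop)
    s e c v :
  (forall f vs c v, call f vs c v -> call' f vs 0 v) ->
  run call s e c v -> run call' s (erase e) 0 v.
Proof.
move=> free; elim: e s c v => //=.
- by move=> x s c v [].
- by move=> w s c v [].
- by move=> d k xs s c v [].
- by move=> f xs s c v [vs ? /free]; exists vs.
- by move=> e IH a s c v [c' _ /IH].
- by move=> o a b s c v [].
- move=> e1 IH1 e2 IH2 e3 IH3 s c v [c1 [c2 [b [_ /IH1 r1 r2]]]].
  exists 0, 0, b; rewrite addr0; split=> //.
  by case: b {r1} r2 => [/IH2|/IH3].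
- move=> x d xs es IH s c v [k [vs [w [sx cv /IH r]]]].
  by exists k, vs, w.
- move=> x e1 IH1 e2 IH2 s c v [c1 [c2 [w [_ /IH1 r1 /IH2 r2]]]].
  by exists 0, 0, w; rewrite addr0.
Qed.

(** * Soundness of typing relative to calls that satisfy their signatures *)

Variable R : realType.
Implicit Types (F Fcf : sigs B R).

Definition sound_call F f vs c v : Prop :=
  forall sg : signature B R, F f sg -> has_tys vs (sig_args sg) ->
    has_ty v (sig_res sg) /\
    forall t, ratr c + sig_post sg t v <= sig_pre sg t vs.

(* The cost is not stored for the cost-free signatures: erasing the ticks of
   the function bodies makes the call free. *)
Definition call_ok F Fcf f vs c v : Prop :=
  sound_call F f vs c v /\ sound_call Fcf f vs 0 v.

(** The hypothesis of [run_erase] by which any run gives a free run suited to the cost-free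
    judgement. *)
Lemma call_ok_free F Fcf f vs c v : call_ok F Fcf f vs c v -> call_ok Fcf Fcf f vs 0 v.
Proof. by case. Qed.

(** Passes between functions of an argument list, as in signatures, and functions of an environment,
    as in judgements. *)
Lemma named_restrict (f : rfun_args B R) (As : seq ty) s xs vs t :
  uniq xs -> size xs = size As ->
  [seq s.[? x] | x <- xs] = [seq Some w | w <- vs] ->
  named xs f t s.[& domf (mkenv xs As)] = f t vs.
Proof.
move=> u sz e; rewrite /named (restrict_mkenv sz e).
by rewrite (pmap_lookup (mkenv_lookup u (size_lookup e))).
Qed.

(** The type of the result is proved along with the bound because (let) extends the environment by a
    computed value. As [F] is an index of [typed], the cost-free premises of (let) get induction
    hypotheses about [call_ok Fcf Fcf]. *)
Lemma typed_run_sound Fcf F Gam G Psi e A Phi :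
  typed Fcf F Gam G Psi e A Phi ->
  forall s c v, run (call_ok F Fcf) s e c v ->
  respects Gam s -> guards_true G s ->
  has_ty v A /\ forall t, ratr c + Phi t v <= Psi t s.[& domf Gam].
Proof.
elim=> {F Gam G Psi e A Phi}.
- move=> F G x A Psi Phi PsiE s c v [-> sx] Gs _.
  have [|w] := Gs x A; first by rewrite fnd_set eqxx.
  rewrite sx => -[<-] vA; split=> // t.
  rewrite rmorph0 add0r -PsiE // (restrict_set _ _ sx).
  by rewrite [s.[& _]](restrictf0 s).
- move=> F G d p k xs Psi Phi uxs pG PsiE s c v [-> [vs e cv]] Gs GS.
  have szv : size vs == arity k by rewrite (con_val_size cv).
  have vA := mkenv_has_tys uxs (etrans (size_tuple _) (esym (size_tuple _))) e Gs.
  have pv : gholds (fun i => Some (tnth (Tuple szv) i)) (p k).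
    case: pG => [->|/GS] //; rewrite gholds_gmap.
    rewrite (eq_gholds (look' := fun i => Some (tnth (Tuple szv) i))) // => i.
    exact: (mkenv_tnth (vs := Tuple szv)).
  split=> [|t].
    apply: (@HT_con _ _ d p k (Tuple szv)) => // i.
    exact: (has_tys_nth (vs := Tuple szv)) vA.
  by rewrite rmorph0 add0r (restrict_mkenv _ e) ?size_tuple // (PsiE t (Tuple szv) v).
- move=> F Gam G x d p xs es A Psi Psis Phi xG uxs xsfr PsiE _ IH s c v
    [k [vs [w [sx cv r]]]] /(respects_set _ _ xG) [Gs [w']].
  rewrite sx => -[<-] wA GS.
  have szv : size vs == arity k by rewrite (con_val_size cv).
  have [pv vA] := @has_ty_con _ _ k (Tuple szv) _ wA cv.
  have look := mkenv_lookup (uxs k) (etrans (size_tuple _) (esym (size_tuple (Tuple szv)))).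
  have xsn y : y \notin xs k -> s.[? y] = (s + mkenv (xs k) vs)%fset.[? y].
    by move=> yxs; rewrite fnd_cat mem_mkenv ?(negPf yxs) ?(eqP szv) ?size_tuple.
  have look' y : y \in xs k -> (s + mkenv (xs k) vs)%fset.[? y] = (mkenv (xs k) vs).[? y].
    by move=> yxs; rewrite fnd_cat mem_mkenv ?yxs ?(eqP szv) ?size_tuple.
  have [||vA' bound] := IH k _ _ _ r.
  + move=> y C; rewrite fnd_cat mem_mkenv ?size_tuple //.
    case: ifPn => yxs; last first.
      by move=> /Gs [u su uC]; exists u => //; rewrite -xsn.
    by rewrite look' //; apply: (respects_mkenv _ vA); rewrite !size_tuple.
  + apply: guards_true_gadd.
      rewrite gholds_gmap -(eq_gholds (look := fun i => Some (tnth (Tuple szv) i))) // => i.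
      by rewrite look' ?mem_tnth // (mkenv_tnth i look).
    by apply: guards_true_fresh xsn GS => y /xsfr [_ []].
  split=> // t; apply: le_trans (bound t) _.
  rewrite (restrict_set _ _ sx) -(PsiE k t _ (Tuple szv)) //; last exact: respects_valuation.
  (* Both sides are [Psis k t] at the same valuation: the pattern variables avoid [domf Gam], where
     the extended substitution agrees with [s]. *)
  rewrite le_eqVlt; apply/orP; left; apply/eqP; congr (_ t _).
  rewrite restrict_cat.
    rewrite (restrict_mkenv (vs := vs)) ?size_tuple //.
      congr catf; apply: eq_restrict => y yG; rewrite -xsn //.
      by apply/negP => /xsfr [_ []]; rewrite yG.
    by rewrite -look; apply/eq_in_map => y yxs; rewrite look'.
  apply/fsubsetP => y; rewrite mem_mkenv ?size_tuple // => yxs.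
  by rewrite mem_catf mem_mkenv ?yxs ?orbT ?(eqP szv) ?size_tuple.
- move=> F Gam G o a b s c v [-> [b' _ ->]] _ _; split=> [|t].
    by case: b'; [apply: (HT_con (c := Ctrue) (vs := [tuple])) => // -[]|
                  apply: (HT_con (c := Cfalse) (vs := [tuple])) => // -[]].
  by rewrite rmorph0 addr0.
- move=> F Gam G e1 e2 e3 A Psi1 Psi2 Phi _ IH1 _ IH2 _ IH3 s c v
    [c1 [c2 [b [-> r1 r2]]]] Gs GS.
  have [_ b1] := IH1 _ _ _ r1 Gs GS.
  have gb := run_guard r1.
  have [vA b2] : has_ty v A /\ forall t, ratr c2 + Phi t v <= Psi2 t s.[& domf Gam].
    case: b {r1} r2 gb => r2 gb; [apply: IH2 r2 Gs _|apply: IH3 r2 Gs _];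
    exact: guards_true_gadd.
  split=> // t; move: (b1 t) (b2 t); rewrite rmorphD /=; lra.
- move=> F Gam Del G x e1 e2 A C Psi Psi1 PsiD Psimix Psi2 Omega Phi1 Phi n
    Psis Phis dis [xGD xG] PsiE Psi2E _ IH1 _ IH2 _ IHs mix s c v
    [c1 [c2 [w [-> r1 r2]]]] Gs GS.
  have Ds := respects_catr Gs.
  have {}Gs := respects_catl dis Gs.
  have xD : x \notin domf Del by move: xGD; rewrite mem_catf negb_or => /andP[].
  have [wA b1] := IH1 _ _ _ r1 Gs GS.
  have sxE y : y \notin pred1 x -> s.[? y] = s.[x <- w].[? y].
    by rewrite inE fnd_set => /negPf ->.
  have [||vC b2] := IH2 _ _ _ r2.
  + apply/respects_set => //; split; last by exists w; rewrite ?fnd_set ?eqxx.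
    apply: eq_respects Ds => y yD; apply: sxE.
    by apply: contraNN xD => /eqP <-.
  + by apply: guards_true_fresh sxE GS => y /eqP ->.
  split=> // t; have rG := respects_valuation Gs; have rD := respects_valuation Ds.
  rewrite restrict_cat; last exact: respects_dom.
  have {}mix := mix _ _ w rG rD wA _ t.
  move: (b1 t) (b2 t).
  rewrite PsiE // restrict_set2 Psi2E // rmorphD /=.
  (* The side condition needs the cost-free bounds at the very value [w] of the costed run; erasing
     [e1] gives a free run to this [w]. *)
  have {}mix : Omega t s.[& domf Del].[x <- w] <= Psimix t (s.[& domf Gam] + s.[& domf Del])%fset.
    apply: mix => i t'.
    have [_ /(_ t')] := IHs i _ _ _ (run_erase (@call_ok_free F Fcf) r1) Gs GS.
    by rewrite rmorph0 add0r.
  (* Summing the bounds for [e1] and [e2] with [mix], the term [Phi1 t w] cancels and [PsiD] is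
     carried over. *)
  lra.
- move=> F G f xs sg Fsg uxs sz s c v [vs e [ok _]] Gs _.
  have vA := mkenv_has_tys uxs sz e Gs.
  have [vR b] := ok _ Fsg vA; split=> // t.
  by rewrite (named_restrict _ _ uxs sz e).
- move=> F G f xs sg sg' k Fsg Fsg' eA eR uxs sz s c v [vs e [ok ok']] Gs _.
  have vA := mkenv_has_tys uxs sz e Gs.
  have [vR b] := ok _ Fsg vA; split=> // t.
  have [|_ /(_ t)] := ok' _ Fsg'; first by rewrite eA.
  rewrite !(named_restrict _ _ uxs sz e).
  (* The cost-free bound charges nothing, so its multiple by [k] can be added without changing the
     cost. *)
  rewrite rmorph0 add0r => b'; rewrite addrA; apply: lerD => //.
  by apply: ler_wpM2l; rewrite // ler0q.
- move=> F Gam G e a A Psi Phi _ IH s c v [c' -> r] Gs GS.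
  have [vA b] := IH _ _ _ r Gs GS; split=> // t.
  by move: (b t); rewrite rmorphD /=; lra.
- move=> F Gam G x A e C Psi Psi' Phi xG PsiE _ IH s c v r
    /(respects_set _ _ xG) [Gs [w sx wA]] GS.
  have [vC b] := IH _ _ _ r Gs GS; split=> // t; apply: le_trans (b t) _.
  by rewrite (restrict_set _ _ sx); apply: PsiE => //; apply: respects_valuation.
- move=> F Gam G e A Psi Phi k _ _ IH s c v r Gs GS.
  have [vA b] := IH _ _ _ r Gs GS; split=> // t.
  by rewrite addrA lerD2r.
- move=> F Gam G x y z A e C Psi Psi' Phi xy xz yz [xG xfr] [yG yfr] zG bx by_ bz
    PsiE _ IH s c v r /(respects_set _ _ zG) [Gs [w sz wA]] GS.
  have sE u : u \notin pred2 x y -> s.[? u] = s.[x <- w].[y <- w].[? u].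
    by rewrite inE negb_or !fnd_set => /andP[/negPf -> /negPf ->].
  have uG u : u \in domf Gam -> u \notin pred2 x y.
    by move=> uG; apply/negP => /orP[] /eqP E; move: uG; rewrite E ?(negPf xG) ?(negPf yG).
  have yGx : y \notin domf Gam.[x <- A].
    by rewrite mem_setf inE negb_or yG andbT; apply/eqP => /esym.
  (* Both copies receive the value [w] of [z]. The renaming fixes the bound variables of [e], which
     differ from [x], [y] and [z], so [run_rename] transports the run. *)
  have [|||vC b] := IH s.[x <- w].[y <- w] c v.
  + apply: run_rename r => [b u bu|u].
      have bne k : ~ binds e k -> (k == b) = false by move=> nk; apply/eqP => E; rewrite E in nk.
      by case: ifP => // /orP[] /eqP ->; rewrite !bne.
    by rewrite !fnd_set; case: eqP; case: eqP.
  + apply/respects_set => //; split; last by exists w; rewrite ?fnd_set ?eqxx.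
    apply/respects_set => //; split.
      by apply: eq_respects Gs => u /uG; apply: sE.
    by exists w; rewrite // !fnd_set eqxx; case: ifP.
  + by apply: guards_true_fresh sE GS => u /orP[] /eqP ->.
  split=> // t; apply: le_trans (b t) _.
  rewrite !restrict_set2 (restrict_set _ _ sz) PsiE //.
  exact: respects_valuation.
- move=> F Gam G e A Psi Psi' Phi Phi' _ IH PsiE PhiE s c v r Gs GS.
  have [vA b] := IH _ _ _ r Gs GS; split=> // t.
  have := PsiE t _ Gs (respects_guards_true GS) GS; have := PhiE t _ vA.
  by move: (b t); lra.
Qed.

(** * From evaluations to runs, and the soundness theorem *)

Lemma eval_run P F Fcf s e c v :
  well_typed P F Fcf -> eval P s e c v -> run (call_ok F Fcf) s e c v.
Proof.
move=> wt; elim=> {s e c v} /=.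
- by [].
- by [].
- by move=> s d k xs vs v e cv; split=> //; exists vs.
- by move=> s o a b r e; split=> //; exists r.
- by move=> s e a c v _ r; exists c.
- move=> s f xs ys e vs c v Pf sz lookup _ r; exists vs => //.
  have [uys tF tFcf] := wt _ _ _ Pf.
  have szv : size ys = size vs by rewrite sz (size_lookup lookup).
  (* Ordinary signatures follow from soundness on the run of the body, cost-free ones from soundness
     on the free run of its erasure. Bodies are typed without guards, so no guard has to be
     checked. *)
  have look := mkenv_lookup uys szv.
  split=> sg Fsg vA.
    have [szA ty] := tF _ Fsg.
    have [||vR b] := typed_run_sound ty r; [exact: respects_mkenv|by []|].
    by split=> // t; rewrite -(named_restrict _ _ uys szA look).
  have [szA ty] := tFcf _ Fsg.
  have [||vR b] := typed_run_sound ty (run_erase (@call_ok_free F Fcf) r).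
  + exact: respects_mkenv.
  + by [].
  by split=> // t; rewrite -(named_restrict _ _ uys szA look).
- by move=> s x e1 e2 c1 c2 w v _ r1 _ r2; exists c1, c2, w.
- by move=> s e1 e2 e3 c1 c2 v _ r1 _ r2; exists c1, c2, true.
- by move=> s e1 e2 e3 c1 c2 v _ r1 _ r2; exists c1, c2, false.
- by move=> s x d xs es k vs w c v sx cv _ r; exists k, vs, w.
Qed.

End Soundness.

Theorem theorem1 (disp : Order.disp_t) (B : orderType disp) (R : realType)
    (P : program B) (F Fcf : sigs B R) (Gam : ctx) (G : guards) (e : expr B)
    (A : ty) (Psi : rfun_env B R) (Phi : rfun B R) (s : subst B) (c : rat)
    (v : value B) :
  well_typed P F Fcf ->
  respects Gam s -> respects_guards Gam G s ->
  eval P s e c v ->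
  (typed Fcf F Gam G Psi e A Phi ->
     guards_true G s ->
     forall t : template B, Psi t s.[& domf Gam] >= ratr c + Phi t v) /\
  (typed_cf Fcf Gam G Psi e A Phi ->
     guards_true G s ->
     forall t : template B, Psi t s.[& domf Gam] >= Phi t v).

Proof.
move=> wt Gs _ /(eval_run wt) r; split=> ty GS t.
  by have [_] := typed_run_sound ty r Gs GS.
have [_ /(_ t)] := typed_run_sound ty (run_erase (@call_ok_free _ _ _ F Fcf) r) Gs GS.
by rewrite rmorph0 add0r.
Qed.
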